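(* Let $r>1$ and let $$a_r(t)=\frac{\left|\ln\left(\frac{(1+t)^{r-1}(1-t)}{1-t^r}\right)\right|}{\ln\left(\frac{(1+t)^r}{1+t^r}\right)},\qquad 0<t\le 1,$$ where the value at $t=1$ is understood as the limit $t\to 1^-$, and $a_r(0)=\lim_{t\to 0^+}a_r(t)$. (i) If $1<r\le 2$, then for every $a>0$ with $a\le \min_{0\le t\le 1}a_r(t)$, setting $\alpha=1+a$, one has $$\frac{1}{1-(1-q)^{\alpha(r-1)}}\ \ge\ \left|\frac{A_n^{\alpha}-G_n^{\alpha}}{A_n^{\alpha}-M_{n,1/r}^{\alpha}}\right|$$ for all $n\ge 2$, all admissible weights ${\bf q}$ and all admissible ${\bf x}$. (ii) If $r\ge 2$, then for every $0<a<1$ with $a\le \min\{1-1/r,\ \min_{0\le t\le 1}a_r(t)\}$, setting $\alpha=1-a$, one has $$\left|\frac{A_n^{\alpha}-G_n^{\alpha}}{A_n^{\alpha}-M_{n,1/r}^{\alpha}}\right|\ \ge\ \frac{1}{1-q^{\alpha(r-1)}}$$ for all $n\ge 2$, all admissible weights ${\bf q}$ and all admissible ${\bf x}$.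
   Context: Let $n\ge 2$. Admissible weights are ${\bf q}=(q_1,\dots,q_n)$ with $q_i>0$ and $\sum_{i=1}^n q_i=1$; $q=\min_i q_i$. Admissible points are ${\bf x}=(x_1,\dots,x_n)$ with $0\le x_1<x_2<\cdots<x_n$. The weighted power means are $M_{n,p}=M_{n,p}({\bf x};{\bf q})=\left(\sum_{i=1}^n q_ix_i^p\right)^{1/p}$ for real $p\neq 0$, and $M_{n,0}=\lim_{p\to 0}M_{n,p}=\prod_{i=1}^n x_i^{q_i}$. We write $A_n=M_{n,1}$ and $G_n=M_{n,0}$. *)

(* Defs.v *)
From mathcomp Require Import all_boot all_order all_algebra.
From mathcomp Require Import all_classical all_reals all_analysis.
Set Implicit Arguments.
Unset Strict Implicit.
Unset Printing Implicit Defensive.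
Import Order.TTheory GRing.Theory Num.Theory.
Import numFieldNormedType.Exports.
Local Open Scope classical_set_scope.
Local Open Scope ring_scope.

Definition admissible_weights (R : realType) (n : nat) (q : 'I_n -> R) : Prop :=
  (forall i, 0 < q i) /\ \sum_(i < n) q i = 1.

Definition admissible_points (R : realType) (n : nat) (x : 'I_n -> R) : Prop :=
  (forall i, 0 <= x i) /\ (forall i j : 'I_n, (i < j)%N -> x i < x j).

(* The initial value 1 is harmless: admissible weights are at most 1. *)
Definition min_weight (R : realType) (n : nat) (q : 'I_n -> R) : R :=
  \big[Num.min/1]_(i < n) q i.

(* [powR] satisfies 0 `^ p = 0 for every p != 0, so a zero coordinate is
   handled as usual for p >= 0; for p < 0 this is meaningful only when all
   x i are positive. *)
Definition power_mean (R : realType) (n : nat) (p : R) (x q : 'I_n -> R) : R :=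
  if p == 0 then \prod_(i < n) x i `^ q i
  else (\sum_(i < n) q i * x i `^ p) `^ p^-1.

Definition arith_mean (R : realType) (n : nat) (x q : 'I_n -> R) : R :=
  power_mean 1 x q.

Definition geom_mean (R : realType) (n : nat) (x q : 'I_n -> R) : R :=
  power_mean 0 x q.

Definition a_formula (R : realType) (r t : R) : R :=
  `| ln ((1 + t) `^ (r - 1) * (1 - t) / (1 - t `^ r)) |
    / ln ((1 + t) `^ r / (1 + t `^ r)).

Definition a_fun (R : realType) (r t : R) : R :=
  if t == 0 then lim (a_formula r s @[s --> (0 : R)^'+])
  else if t == 1 then lim (a_formula r s @[s --> (1 : R)^'-])
  else a_formula r t.

(* For r > 1 the function [a_fun r] is continuous on `[0, 1], so this infimum
   is attained. *)
Definition min_a (R : realType) (r : R) : R :=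
  inf [set a_fun r t | t in `[0, 1]%classic].

Definition mean_ratio (R : realType) (n : nat) (r alpha : R)
    (x q : 'I_n -> R) : R :=
  `| (arith_mean x q `^ alpha - geom_mean x q `^ alpha)
     / (arith_mean x q `^ alpha - power_mean r^-1 x q `^ alpha) |.

(* Main.v *)
Require Import Defs.
From mathcomp Require Import all_boot all_order all_algebra.
From mathcomp Require Import all_classical all_reals all_analysis.
From mathcomp Require Import ring lra.
Import Order.TTheory GRing.Theory Num.Theory.
Import numFieldNormedType.Exports.
Local Open Scope ring_scope.

(** Write A for the arithmetic mean, G for the geometric mean and
    M = m^r for the power mean of order 1/r, where m is the arithmetic mean of
    the y_i = x_i^(1/r).  With C = (1 - q)^(alpha (r - 1)) in the first case and
    C = q^(alpha (r - 1)) in the second, and since G <= A and M < A, both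
    assertions are equivalent to a statement on the sign of
      C A^alpha + (1 - C) G^alpha - m^(r alpha),
    which is nonnegative in the first case and nonpositive in the second.

    This expression is homogeneous, so its sign is decided on the simplex
    A = 1, where m^(r alpha) - (1 - C) G^alpha attains its extremum kappa; the
    claim is kappa <= C, respectively kappa >= C.  At an extremum with some
    x_k = 0 the geometric mean vanishes, and only m and A have to be compared:
    this is Jensen's inequality over the remaining coordinates
    ([rmean_vanishing_coord]), respectively superadditivity of s |-> s^r
    ([rmean_superadditive]).  At an interior extremum each coordinate satisfies
      kappa A^(alpha - 1) x_i + (1 - C) G^alpha = m^(r alpha - 1) x_i^(1/r)
    ([defect_stationary]).  This equation says that the graph of a strictly
    convex power meets a line, so at most two values occur among the x_i.  If
    there is only one, then kappa = C.  If there are two, let t < 1 be the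
    ratio of the corresponding y_i and Q the total weight of the larger value;
    subtracting the two equations gives
      kappa (Q + (1 - Q) t^r)^(alpha - 1) (1 - t^r)
        = (Q + (1 - Q) t)^(r alpha - 1) (1 - t)
    ([critical_point_two_values]), where Q and 1 - Q are both at least q since
    each value is taken by at least one coordinate.

    There remains an inequality between Q and t.  For Q = 1/2 it is the
    hypothesis a <= a_r(t) with the logarithms removed
    ([equal_weights_upper], [equal_weights_lower]).  The passage to other
    weights ([two_point_upper], [two_point_lower]) is by monotonicity in
    s = (1 - Q)/Q or s = Q/(1 - Q), except when the larger value has the smaller
    weight in the first case; there, after extracting a root, a linear function
    of s is bounded by a concave one, and the endpoints s = 0 and s = 1
    suffice. *)

(** * Bernoulli's inequality and tangent lines of powers *)

Lemma ln_lt_sub1 (R : realType) (z : R) : 0 < z -> z != 1 -> ln z < z - 1.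
Proof.
move=> z0 z1.
have := @expR_gt1Dx R (ln z); rewrite ln_eq0// => /(_ z1).
by rewrite lnK ?posrE// => h; rewrite ltrBrDl.
Qed.

(** With w = 1 + p (x - 1), the inequality ln z <= z - 1 at z = x / w and at
    z = 1 / w, averaged with weights p and 1 - p, has right-hand side 0. *)
Lemma powR_lt_bernoulli (R : realType) (p x : R) : 0 < p < 1 -> 0 < x ->
  x != 1 -> x `^ p < 1 + p * (x - 1).
Proof.
move=> /andP[p0 p1] x0 x1.
set w := 1 + p * (x - 1).
have w0 : 0 < w.
  have := mulr_gt0 p0 x0; rewrite /w; lra.
have w1 : w != 1.
  rewrite /w -subr_eq0 addrAC subrr add0r mulf_eq0 negb_or gt_eqF//=.
  by rewrite subr_eq0.
have h1 : ln w^-1 < w^-1 - 1.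
  apply: ln_lt_sub1; first by rewrite invr_gt0.
  by rewrite -[X in _ != X]invr1 (inj_eq invr_inj).
have h2 : ln (x / w) <= x / w - 1.
  have [->|h] := eqVneq (x / w) 1; first by rewrite ln1 subrr.
  by apply/ltW/ln_lt_sub1 => //; rewrite divr_gt0.
rewrite -ltr_ln ?posrE ?powR_gt0// ln_powR.
move: h1 h2; rewrite ln_div ?posrE// lnV ?posrE// => h1 h2.
have e : p * (x / w - 1) + (1 - p) * (w^-1 - 1) = 0.
  have w00 : w != 0 by rewrite gt_eqF.
  rewrite /w in w00 *; by field.
have := ler_wpM2l (ltW p0) h2.
have p1' : 0 < 1 - p by rewrite subr_gt0.
have := h1; rewrite -(ltr_pM2l p1').
lra.
Qed.

(** The case 0 < p < 1, applied to x^r with the exponent p = 1 / r. *)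
Lemma powR_gt_bernoulli (R : realType) (r x : R) : 1 < r -> 0 <= x ->
  x != 1 -> 1 + r * (x - 1) < x `^ r.
Proof.
move=> r1 x0 x1.
have r0 : 0 < r by apply: lt_trans r1.
move: x0; rewrite le_eqVlt => /orP[/eqP<-|x0].
  by rewrite powR0 ?gt_eqF//; lra.
have := @powR_lt_bernoulli R r^-1 (x `^ r).
have rr : r != 0 by rewrite gt_eqF.
rewrite -powRrM divff// powRr1 ?(ltW x0)//.
rewrite invr_gt0 r0 invf_lt1// r1 => /(_ isT (powR_gt0 _ x0)).
rewrite powR_eq1 !negb_or x1 /= -leNgt (ltW x0) rr => /(_ isT).
rewrite -(ltr_pM2l r0) mulrDr mulrA divff// mul1r mulr1; lra.
Qed.

Lemma powR_le_bernoulli (R : realType) (p x : R) : 0 <= p <= 1 -> 0 < x ->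
  x `^ p <= 1 + p * (x - 1).
Proof.
move=> /andP[p0 p1] x0.
have [->|x1] := eqVneq x 1; first by rewrite powR1 subrr mulr0 addr0.
move: p0; rewrite le_eqVlt => /orP[/eqP<-|p0]; first by rewrite powRr0 mul0r addr0.
move: p1; rewrite le_eqVlt => /orP[/eqP->|p1].
  by rewrite powRr1 ?(ltW x0)// mul1r addrC subrK.
by apply/ltW/powR_lt_bernoulli => //; rewrite p0.
Qed.

Lemma powR_ge_bernoulli (R : realType) (r x : R) : 1 <= r -> 0 <= x ->
  1 + r * (x - 1) <= x `^ r.
Proof.
move=> r1 x0.
have [->|x1] := eqVneq x 1; first by rewrite powR1 subrr mulr0 addr0.
move: r1; rewrite le_eqVlt => /orP[/eqP<-|r1].
  by rewrite powRr1//; lra.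
exact/ltW/powR_gt_bernoulli.
Qed.

Lemma powR_gt_tangent (R : realType) (r x z : R) : 1 < r -> 0 <= x -> 0 < z ->
  x != z -> z `^ r + r * z `^ (r - 1) * (x - z) < x `^ r.
Proof.
move=> r1 x0 z0 xz.
have := @powR_gt_bernoulli R r (x / z) r1; rewrite divr_ge0 ?(ltW z0)// => /(_ isT).
have -> : (x / z != 1).
  by by rewrite -(inj_eq (mulIf (lt0r_neq0 z0))) mul1r divfK ?lt0r_neq0.
move=> /(_ isT); rewrite -(ltr_pM2l (powR_gt0 r z0)).
rewrite -powRM ?divr_ge0 ?(ltW z0)// mulrCA divff ?gt_eqF// mulr1.
apply: le_lt_trans; rewrite le_eqVlt; apply/orP; left; apply/eqP.
rewrite -(mulr_powRB1 (ltW z0) (lt_trans ltr01 r1)); field.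
by rewrite gt_eqF.
Qed.

Lemma powR_ge_tangent (R : realType) (r x z : R) : 1 < r -> 0 <= x -> 0 < z ->
  z `^ r + r * z `^ (r - 1) * (x - z) <= x `^ r.
Proof.
move=> r1 x0 z0; have [->|xz] := eqVneq x z; first by rewrite subrr mulr0 addr0.
exact/ltW/powR_gt_tangent.
Qed.

Lemma powR_concave (R : realType) (p a b s : R) : 0 <= p <= 1 -> 0 < a -> 0 < b ->
  0 <= s <= 1 -> (1 - s) * a `^ p + s * b `^ p <= ((1 - s) * a + s * b) `^ p.
Proof.
move=> p01 a0 b0 /andP[s0 s1].
set z := (1 - s) * a + s * b.
have z0 : 0 < z.
  move: s1; rewrite le_eqVlt => /orP[/eqP e|s1].
    by rewrite /z e subrr mul0r mul1r add0r.
  by apply: ltr_wpDr; rewrite ?mulr_ge0 ?(ltW b0)// mulr_gt0// subr_gt0.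
have tan x : 0 < x -> x `^ p <= z `^ p * (1 + p * (x / z - 1)).
  move=> x0; have -> : x `^ p = z `^ p * (x / z) `^ p.
    rewrite -powRM ?divr_ge0 ?(ltW z0) ?(ltW x0)//.
    by rewrite mulrCA divff ?gt_eqF// mulr1.
  by rewrite ler_wpM2l ?powR_ge0// powR_le_bernoulli// divr_gt0.
have s1' : 0 <= 1 - s by rewrite subr_ge0.
have := lerD (ler_wpM2l s1' (tan _ a0)) (ler_wpM2l s0 (tan _ b0)).
move=> h; apply: (le_trans h).
rewrite le_eqVlt; apply/orP; left; apply/eqP.
have zz : z != 0 by rewrite gt_eqF.
by rewrite /z in zz *; field.
Qed.

(** * The inequality for two distinct values *)

(** The weight P of the normalised point enters both sides: since a = e + b, the
    factor P^a on the left exceeds P^b on the right by P^e, and w bounds P. *)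
Lemma powR_scale_upper (R : realType) (a b e P w W X Y : R) :
  0 < P -> P <= w -> 0 <= e -> a = e + b -> 0 <= X -> 0 <= Y -> 0 <= W ->
  X `^ a <= W * Y `^ b -> (P * X) `^ a <= w `^ e * W * (P * Y) `^ b.
Proof.
move=> P0 Pw e0 -> X0 Y0 W0 h.
have P0' := ltW P0.
rewrite !powRM// [P `^ _]powRD; last by rewrite (gt_eqF P0) implybT.
rewrite -!mulrA; apply: (@le_trans _ _ (P `^ e * (P `^ b * (W * Y `^ b)))).
  by rewrite !ler_wpM2l ?powR_ge0.
rewrite [W * (_ * _)]mulrCA ler_wpM2r ?mulr_ge0 ?powR_ge0//.
by rewrite ge0_ler_powR// nnegrE (le_trans P0').
Qed.

Lemma powR_scale_lower (R : realType) (a b e P w W X Y : R) :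
  0 < P -> 0 <= w -> w <= P -> 0 <= e -> a = e + b -> 0 <= X -> 0 <= Y -> 0 <= W ->
  W * Y `^ b <= X `^ a -> w `^ e * W * (P * Y) `^ b <= (P * X) `^ a.
Proof.
move=> P0 w0 wP e0 -> X0 Y0 W0 h.
have P0' := ltW P0.
rewrite !powRM// [P `^ (_ + _)]powRD; last by rewrite (gt_eqF P0) implybT.
rewrite -!mulrA; apply: (@le_trans _ _ (P `^ e * (P `^ b * (W * Y `^ b)))).
  rewrite [W * (_ * _)]mulrCA ler_wpM2r ?mulr_ge0 ?powR_ge0//.
  by rewrite ge0_ler_powR// nnegrE.
by rewrite !ler_wpM2l ?powR_ge0.
Qed.

Lemma powR_lt_id (R : realType) (r t : R) : 1 < r -> 0 < t < 1 -> t `^ r < t.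
Proof.
move=> r1 /andP[t0 t1].
rewrite -mulr_powRB1 ?(ltW t0) ?(lt_trans ltr01)//.
rewrite gtr_pMr//.
have := @gt0_ltr_powR R (r - 1); rewrite subr_gt0 => /(_ r1 t 1).
by rewrite powR1 !nnegrE (ltW t0) ler01 => /(_ isT isT t1).
Qed.

Section TwoPoint.
Variables (R : realType) (r alpha t Q w : R).
Hypotheses (r1 : 1 < r) (t01 : 0 < t < 1) (Q01 : 0 < Q < 1).
Let u := t `^ r.
Let a := r * alpha - 1.
Let b := alpha - 1.
Let e := alpha * (r - 1).

Let t0 : 0 < t. Proof. by case/andP: t01. Qed.
Let t1 : t < 1. Proof. by case/andP: t01. Qed.
Let Q0 : 0 < Q. Proof. by case/andP: Q01. Qed.
Let Q1 : 0 < 1 - Q. Proof. by case/andP: Q01; rewrite subr_gt0. Qed.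
Let u0 : 0 < u. Proof. exact: powR_gt0. Qed.
Let ut : u < t. Proof. exact: powR_lt_id. Qed.
Let u1 : u < 1. Proof. exact: lt_trans t1. Qed.
Let aeb : a = e + b. Proof. by rewrite /a /e /b; ring. Qed.

Lemma mix_head x : Q + (1 - Q) * x = Q * (1 + (1 - Q) / Q * x).
Proof. by field; rewrite gt_eqF. Qed.

Lemma mix_tail x : Q + (1 - Q) * x = (1 - Q) * (Q / (1 - Q) + x).
Proof. by field; rewrite gt_eqF. Qed.

(** For 1 - Q <= Q, in terms of s = (1 - Q) / Q, the quotient
    (1 + s t)^a / (1 + s u)^b = (1 + s t)^e ((1 + s t) / (1 + s u))^b
    increases with s because u <= t, so s = 1 is the worst case.  For
    Q < 1 - Q, in terms of s = Q / (1 - Q), the quotient (s + t)^a / (s + u)^b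
    need not be monotone.  But s + t <= V (s + u)^(b / a) compares a linear
    function of s with a concave one, hence follows from s = 0, where it holds
    by t^a <= t^(r b), and from s = 1. *)
Lemma two_point_upper : 1 <= alpha -> Q <= w -> 1 - Q <= w ->
  (1 + t) `^ (r * alpha - 1) * (1 - t)
     <= (1 + t `^ r) `^ (alpha - 1) * (1 - t `^ r) ->
  (Q + (1 - Q) * t) `^ (r * alpha - 1) * (1 - t)
     <= w `^ (alpha * (r - 1))
        * ((Q + (1 - Q) * t `^ r) `^ (alpha - 1) * (1 - t `^ r)).
Proof.
move=> al1 Qw Q'w; rewrite -/u -/a -/b -/e.
have b0 : 0 <= b by rewrite subr_ge0.
have e0 : 0 < e by rewrite mulr_gt0 ?subr_gt0// (lt_le_trans ltr01).
have a0 : 0 < a by rewrite aeb ltr_pwDl.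
have t1' : 0 < 1 - t by rewrite subr_gt0.
set W := (1 - u) / (1 - t).
have W1 : 1 <= W by rewrite /W ler_pdivlMr// mul1r lerD2l lerN2 ltW.
have W0 : 0 < W := lt_le_trans ltr01 W1.
rewrite -ler_pdivlMr// -mulrA => H.
rewrite -ler_pdivlMr// -!mulrA [_ * (_ / _)]mulrC mulrA -/W.
rewrite -/W [_ * W]mulrC in H.
move: W W1 W0 H => W W1 W0 H.
have [Q12|Q12] := leP (1 - Q) Q.
  rewrite !mix_head; set s := (1 - Q) / Q.
  have s0 : 0 < s by rewrite divr_gt0.
  have s1 : s <= 1 by rewrite /s ler_pdivrMr// mul1r.
  move: s s0 s1 => s s0 s1.
  have st : 0 <= s * t by rewrite mulr_ge0 ?ltW.
  have su : 0 <= s * u by rewrite mulr_ge0 ?ltW.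
  apply: powR_scale_upper => //; rewrite ?addr_ge0 ?(ltW e0) ?(ltW W0)//.
  rewrite -(ler_pM2r (powR_gt0 b (_ : 0 < 1 + u))); last by rewrite addr_gt0.
  apply: (@le_trans _ _ ((1 + t) `^ a * (1 + s * u) `^ b)); last first.
    by rewrite [W * _ * _]mulrAC ler_wpM2r ?powR_ge0.
  have split x : 0 <= x -> (1 + x) `^ a = (1 + x) `^ e * (1 + x) `^ b.
    move=> x0; rewrite aeb powRD//; apply/implyP => _.
    by rewrite gt_eqF// ltr_pwDl.
  rewrite !split ?(ltW t0)// -!mulrA.
  apply: ler_pM; rewrite ?mulr_ge0 ?powR_ge0//.
    rewrite ge0_ler_powR ?(ltW e0)// ?nnegrE ?addr_ge0 ?(ltW t0)//.
    by rewrite lerD2l ler_piMl ?(ltW t0).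
  rewrite -!powRM ?addr_ge0 ?(ltW t0) ?(ltW u0)//.
  rewrite ge0_ler_powR// ?nnegrE ?mulr_ge0 ?addr_ge0 ?(ltW t0) ?(ltW u0)//.
  rewrite -subr_ge0.
  have -> : (1 + t) * (1 + s * u) - (1 + s * t) * (1 + u) = (1 - s) * (t - u).
    by ring.
  by rewrite mulr_ge0 ?subr_ge0// ltW.
rewrite !mix_tail; set s := Q / (1 - Q).
have s0 : 0 < s by rewrite divr_gt0.
have s1 : s <= 1 by rewrite /s ler_pdivrMr// mul1r ltW.
move: s s0 s1 => s s0 s1.
apply: powR_scale_upper; rewrite ?addr_ge0 ?(ltW s0) ?(ltW u0) ?(ltW t0) ?(ltW e0) ?(ltW W0)//.
(* The bound W is absorbed by extracting the root of order a, which turns the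
   left-hand side into a linear function of s. *)
pose V := W `^ a^-1; pose beta := b / a.
have aa : a != 0 by rewrite gt_eqF.
have beta01 : 0 <= beta <= 1.
  rewrite divr_ge0 ?(ltW a0)//= ler_pdivrMr// mul1r -subr_ge0.
  by rewrite (_ : a - b = e) ?(ltW e0)// aeb addrK.
have VE : W = V `^ a by rewrite /V -powRrM mulVf// powRr1// ltW.
have Vr x y : 0 <= x -> 0 <= y -> x `^ a <= W * y `^ b -> x <= V * y `^ beta.
  move=> x0 y0 h.
  rewrite -[x](powRr1 x0) -(mulfV aa) powRrM /V /beta powRrM -powRM ?powR_ge0 ?(ltW W0)//.
  by rewrite ge0_ler_powR ?invr_ge0 ?(ltW a0)// nnegrE ?mulr_ge0 ?powR_ge0 ?(ltW W0).
have V1 : 1 + t <= V * (1 + u) `^ beta.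
  by apply: Vr H; rewrite addr_ge0 ?(ltW t0) ?(ltW u0).
have V0 : t <= V * u `^ beta.
  apply: Vr; rewrite ?(ltW t0) ?(ltW u0)//.
  apply: (@le_trans _ _ (1 * u `^ b)); last by rewrite ler_wpM2r ?powR_ge0.
  by rewrite mul1r /u -powRrM ger_powR ?t0 ?(ltW t1)// /a /b mulrBr mulr1 lerD2l lerN2 ltW.
have -> : W * (s + u) `^ b = (V * (s + u) `^ beta) `^ a.
  by rewrite powRM ?powR_ge0// -VE -powRrM divfK.
rewrite ge0_ler_powR ?(ltW a0)// ?nnegrE ?mulr_ge0 ?addr_ge0 ?powR_ge0 ?(ltW s0) ?(ltW t0)//.
have s01 : 0 <= s <= 1 by rewrite (ltW s0).
have := @powR_concave R beta u (1 + u) s beta01 u0 (addr_gt0 ltr01 u0) s01.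
have -> : (1 - s) * u + s * (1 + u) = s + u by ring.
have V00 : 0 <= V by rewrite powR_ge0.
move/(ler_wpM2l V00); apply: le_trans.
have s1' : 0 <= 1 - s by rewrite subr_ge0.
have := lerD (ler_wpM2l s1' V0) (ler_wpM2l (ltW s0) V1).
by move=> h; lra.
Qed.

(** As alpha <= 1 <= r alpha, the exponents r alpha - 1 >= 0 >= alpha - 1 make
    the quotient increase with s, and choosing for s the ratio of the larger
    weight to the smaller one gives s >= 1. *)
Lemma two_point_lower : 0 < alpha <= 1 -> 1 <= r * alpha ->
  0 <= w -> w <= Q -> w <= 1 - Q ->
  (1 + t `^ r) `^ (alpha - 1) * (1 - t `^ r)
     <= (1 + t) `^ (r * alpha - 1) * (1 - t) ->
  w `^ (alpha * (r - 1))
        * ((Q + (1 - Q) * t `^ r) `^ (alpha - 1) * (1 - t `^ r))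
  <= (Q + (1 - Q) * t) `^ (r * alpha - 1) * (1 - t).
Proof.
move=> /andP[al0 al1] ral w0 wQ wQ'; rewrite -/u -/a -/b -/e.
have a0 : 0 <= a by rewrite subr_ge0.
have e0 : 0 <= e by rewrite mulr_ge0 ?subr_ge0// ltW.
have b0 : 0 <= - b by rewrite opprB subr_ge0.
have t1' : 0 < 1 - t by rewrite subr_gt0.
set W := (1 - u) / (1 - t).
have W0 : 0 <= W by rewrite divr_ge0 ?subr_ge0 ?ltW.
move=> H; rewrite -ler_pdivrMr// -mulrA [_ `^ b * _]mulrC -/W in H.
rewrite -ler_pdivrMr// -!mulrA [_ `^ b * _]mulrC -/W.
move: W W0 H => W W0 H.
rewrite mulrA; have key x y x' y' : 0 < y -> y <= y' -> 0 <= x -> x <= x' ->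
    W * y `^ b <= x `^ a -> W * y' `^ b <= x' `^ a.
  move=> y0 yy x0 xx h; apply: (@le_trans _ _ (x `^ a)); last first.
    by apply: ge0_ler_powR => //; rewrite nnegrE (le_trans x0).
  apply: le_trans h; rewrite ler_wpM2l// -[b]opprK !(powRN _ (- b)).
  rewrite lef_pV2 ?posrE ?powR_gt0 ?(lt_le_trans y0)//.
  by rewrite ge0_ler_powR// nnegrE ltW// (lt_le_trans y0).
have [Q12|Q12] := leP Q (1 - Q).
  rewrite !mix_head; set s := (1 - Q) / Q.
  have s1 : 1 <= s by rewrite /s ler_pdivlMr// mul1r.
  move: s s1 => s s1.
  have s0 : 0 <= s := le_trans ler01 s1.
  have st : t <= s * t by rewrite ler_peMl ?(ltW t0).
  have su : u <= s * u by rewrite ler_peMl ?(ltW u0).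
  apply: powR_scale_lower; rewrite ?e0 ?addr_ge0 ?mulr_ge0 ?(ltW t0) ?(ltW u0)//.
  by apply: key H; rewrite ?addr_gt0 ?addr_ge0 ?lerD2l ?(ltW t0).
rewrite !mix_tail; set s := Q / (1 - Q).
have s1 : 1 <= s by rewrite /s ler_pdivlMr// mul1r ltW.
move: s s1 => s s1.
have s0 : 0 <= s := le_trans ler01 s1.
apply: powR_scale_lower; rewrite ?e0 ?addr_ge0 ?mulr_ge0 ?(ltW t0) ?(ltW u0)//.
by apply: key H; rewrite ?addr_gt0 ?addr_ge0 ?lerD2r ?(ltW t0).
Qed.
End TwoPoint.

(** * The hypothesis as the case of equal weights *)

(** The infimum of a set which is not bounded below is 0 by convention, which
    a > 0 excludes. *)
Lemma a_formula_ge_of_min_a (R : realType) (r a t : R) : 0 < a -> a <= min_a r ->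
  0 < t < 1 -> a <= a_formula r t.
Proof.
move=> a0 am /andP[t0 t1].
have [hi|ho] := pselect (has_inf [set a_fun r t | t in `[0, 1]%classic]); last first.
  by move: am; rewrite /min_a inf_out// leNgt a0.
apply: (le_trans am); apply: ge_inf; first by case: hi.
exists t; first by rewrite /= in_itv /= !ltW.
by rewrite /a_fun gt_eqF ?lt_eqF.
Qed.

(** Determines the sign of the logarithm inside the absolute value: with
    p = r - 1 <= 1, Bernoulli's inequality bounds both (1 + t)^p by 1 + p t and
    t^p by 1 + p (t - 1), and the two bounds match. *)
Lemma two_point_numer_le (R : realType) (r t : R) : 1 < r <= 2 -> 0 < t < 1 ->
  (1 + t) `^ (r - 1) * (1 - t) <= 1 - t `^ r.
Proof.
move=> /andP[r1 r2] /andP[t0 t1].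
have p01 : 0 <= r - 1 <= 1 by apply/andP; split; lra.
have h1 := @powR_le_bernoulli R (r - 1) (1 + t) p01 (addr_gt0 ltr01 t0).
have h2 := @powR_le_bernoulli R (r - 1) t p01 t0.
rewrite -(mulr_powRB1 (ltW t0) (lt_trans ltr01 r1)).
have t1' : 0 <= 1 - t by rewrite subr_ge0 ltW.
have := ler_wpM2r t1' h1.
have := ler_wpM2l (ltW t0) h2.
rewrite (_ : t * (1 + (r - 1) * (t - 1)) =
  1 - (1 + (r - 1) * (1 + t - 1)) * (1 - t)); [lra | ring].
Qed.

Lemma two_point_numer_ge (R : realType) (r t : R) : 2 <= r -> 0 < t < 1 ->
  1 - t `^ r <= (1 + t) `^ (r - 1) * (1 - t).
Proof.
move=> r2 /andP[t0 t1].
have p1 : 1 <= r - 1 by lra.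
have h1 := @powR_ge_bernoulli R (r - 1) (1 + t) p1 (addr_ge0 ler01 (ltW t0)).
have h2 := @powR_ge_bernoulli R (r - 1) t p1 (ltW t0).
rewrite -(@mulr_powRB1 _ t r (ltW t0)); last by lra.
have t1' : 0 <= 1 - t by rewrite subr_ge0 ltW.
have := ler_wpM2r t1' h1.
have := ler_wpM2l (ltW t0) h2.
rewrite (_ : t * (1 + (r - 1) * (t - 1)) =
  1 - (1 + (r - 1) * (1 + t - 1)) * (1 - t)); [lra | ring].
Qed.

Section EqualWeights.
Variables (R : realType) (r a t : R).
Hypotheses (r1 : 1 < r) (a0 : 0 < a) (am : a <= min_a r) (t01 : 0 < t < 1).

Let t0 : 0 < t. Proof. by case/andP: t01. Qed.
Let t1 : 0 < 1 - t. Proof. by case/andP: t01; rewrite subr_gt0. Qed.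
Let u0 : 0 < 1 + t `^ r. Proof. by rewrite ltr_pwDl ?powR_ge0. Qed.
Let u1 : 0 < 1 - t `^ r.
Proof. by rewrite subr_gt0 (lt_trans (powR_lt_id _ _ _ r1 t01))// -subr_gt0. Qed.
Let T0 : 0 < 1 + t. Proof. by rewrite addr_gt0. Qed.

Let key : a * (r * ln (1 + t) - ln (1 + t `^ r)) <=
  `|(r - 1) * ln (1 + t) + ln (1 - t) - ln (1 - t `^ r)|.
Proof.
have := a_formula_ge_of_min_a _ _ _ _ a0 am t01; rewrite /a_formula.
rewrite !ln_div ?posrE ?mulr_gt0 ?powR_gt0// lnM ?posrE ?powR_gt0// !ln_powR.
set N := `|_|; set D := (X in N / X) => h.
have N0 : 0 <= N by exact: normr_ge0.
(* The quotient N / D is positive, being at least a. *)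
have D0 : 0 < D.
  rewrite ltNge; apply/negP => D0.
  have : N / D <= 0 by rewrite mulr_ge0_le0// invr_le0.
  by move=> h2; have := lt_le_trans a0 (le_trans h h2); rewrite ltxx.
by rewrite -ler_pdivlMr.
Qed.

Lemma equal_weights_upper : r <= 2 ->
  (1 + t) `^ (r * (1 + a) - 1) * (1 - t)
     <= (1 + t `^ r) `^ (1 + a - 1) * (1 - t `^ r).
Proof.
move=> r2; have r12 : 1 < r <= 2 by rewrite r1.
have h := two_point_numer_le _ _ _ r12 t01.
rewrite -ler_ln ?posrE ?mulr_gt0 ?powR_gt0// lnM ?posrE ?powR_gt0// ln_powR in h.
move: key; rewrite ler0_norm; last by rewrite subr_le0.
move=> k; rewrite -ler_ln ?posrE ?mulr_gt0 ?powR_gt0//.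
rewrite !lnM ?posrE ?powR_gt0// !ln_powR; lra.
Qed.

Lemma equal_weights_lower : 2 <= r ->
  (1 + t `^ r) `^ (1 - a - 1) * (1 - t `^ r)
     <= (1 + t) `^ (r * (1 - a) - 1) * (1 - t).
Proof.
move=> r2.
have h := two_point_numer_ge _ _ _ r2 t01.
rewrite -ler_ln ?posrE ?mulr_gt0 ?powR_gt0// lnM ?posrE ?powR_gt0// ln_powR in h.
move: key; rewrite ger0_norm; last by rewrite subr_ge0.
move=> k; rewrite -ler_ln ?posrE ?mulr_gt0 ?powR_gt0//.
rewrite !lnM ?posrE ?powR_gt0// !ln_powR; lra.
Qed.

End EqualWeights.

(** * Extrema on the simplex *)

(** The absolute value makes the power continuous at 0 from both sides, which
    lets functions of nonnegative coordinates be extended continuously to the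
    whole space. *)
Lemma continuous_powR_norm (R : realType) (p : R) : 0 < p ->
  continuous (fun z : R => `|z| `^ p).
Proof.
move=> p0 z; have [->|z0] := eqVneq z 0.
  rewrite /continuous_at normr0 powR0 ?gt_eqF//.
  apply/cvgr0Pnorm_lt => e e0; near=> y.
  rewrite ger0_norm ?powR_ge0//.
  rewrite -[ltRHS](powRr1 (ltW e0)) -(mulVf (lt0r_neq0 p0)) powRrM.
  rewrite gt0_ltr_powR ?nnegrE ?normr_ge0 ?powR_ge0//.
  near: y.
  have : 0 < e `^ p^-1 by rewrite powR_gt0.
  exact: (@cvgr0_norm_lt _ _ _ _ _ id cvg_id).
apply: (@continuous_comp _ _ _ (@Num.norm R R) (@powR R ^~ p)).
  exact: norm_continuous.
apply/differentiable_continuous/derivable1_diffP.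
by apply: derivable_powR; rewrite in_itv/= andbT normr_gt0.
Unshelve. all: by end_near. Qed.

Definition wsum {R : realType} {n : nat} (q x : 'I_n -> R) : R :=
  \sum_(i < n) q i * x i.

Lemma continuous_sum_coord (R : realType) (n : nat) (F : 'I_n -> R -> R) :
  (forall i, continuous (F i)) ->
  continuous (fun v : 'rV[R]_n => \sum_(i < n) F i (v ord0 i)).
Proof.
move=> cF; apply: continuous_big; first exact: add_continuous.
move=> i _ v.
apply: (@continuous_comp _ _ _ (fun v : 'rV[R]_n => v ord0 i) (F i)).
  exact: coord_continuous.
exact: cF.
Qed.

Lemma continuous_prod_coord (R : realType) (n : nat) (F : 'I_n -> R -> R) :
  (forall i, continuous (F i)) ->
  continuous (fun v : 'rV[R]_n => \prod_(i < n) F i (v ord0 i)).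
Proof.
move=> cF; apply: continuous_big; first exact: mul_continuous.
move=> i _ v.
apply: (@continuous_comp _ _ _ (fun v : 'rV[R]_n => v ord0 i) (F i)).
  exact: coord_continuous.
exact: cF.
Qed.

(** The simplex is closed in the product of the intervals [0, 1 / q_i], hence
    compact.  Since K is meaningful at nonnegative arguments only, its continuity
    is asked for after composition with the absolute values. *)
Lemma simplex_max (R : realType) (n : nat) (q : 'I_n -> R)
    (K : ('I_n -> R) -> R) :
  admissible_weights q ->
  continuous (fun v : 'rV[R]_n => K (fun i => `|v ord0 i|)) ->
  exists x, [/\ forall i, 0 <= x i, wsum q x = 1 &
    forall y, (forall i, 0 <= y i) -> wsum q y = 1 -> K y <= K x].
Proof.
move=> [q0 q1] cK.
pose S : set 'rV[R]_n := [set v : 'rV[R]_n | forall i, `[0, (q i)^-1]%classic (v ord0 i)]%classic.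
pose L : set 'rV[R]_n := [set v : 'rV[R]_n | \sum_(i < n) q i * v ord0 i = 1]%classic.
have cS : compact S.
  by apply: (@rV_compact R n (fun i => `[0, (q i)^-1]%classic)) => i; exact: segment_compact.
have cL : closed L.
  have := @continuous_sum_coord R n (fun i z => q i * z).
  move=> /(_ (fun i => @mulrl_continuous R (q i))) /continuous_closedP.
  by move=> /(_ [set x | x = 1]%classic (@closed_eq R 1)).
have inS (y : 'I_n -> R) : (forall i, 0 <= y i) -> wsum q y = 1 ->
    (S `&` L)%classic (\row_i y i).
  move=> y0 y1; split => [i|] /=; last first.
    by rewrite /L /= -[RHS]y1; apply: eq_bigr => i _; rewrite mxE.
  rewrite /= mxE in_itv/= y0/= -[leRHS]mul1r ler_pdivlMr// mulrC -y1.
  rewrite /wsum (bigD1 i)//= lerDl sumr_ge0// => j _.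
  by rewrite mulr_ge0// ltW.
have [|||v vSL vmax] := @EVT_max_rV R n (fun v => K (fun i => `|v ord0 i|)) (S `&` L)%classic.
- exists (\row_i 1); apply: inS => //; rewrite -[RHS]q1.
  by apply: eq_bigr => i _; rewrite mulr1.
- exact: compact_closedI.
- exact: continuous_subspaceT.
move: vSL; rewrite inE => -[/= vS vL].
have v0 i : 0 <= v ord0 i by have := vS i; rewrite /= in_itv/= => /andP[].
exists (fun i => v ord0 i); split=> // y y0 y1.
have := vmax (\row_i y i); rewrite inE => /(_ (inS _ y0 y1)).
congr (_ <= _); congr (K _); apply/funext => i; rewrite ?mxE ger0_norm//.
Qed.

(** * Stationarity of interior extrema *)

Definition gmean {R : realType} {n : nat} (q x : 'I_n -> R) : R :=
  \prod_(i < n) x i `^ q i.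

(** The mean m = M_{n,1/r}^(1/r), so that M_{n,1/r}^alpha is the power
    m^(r alpha). *)
Definition rmean {R : realType} {n : nat} (r : R) (q x : 'I_n -> R) : R :=
  wsum q (fun i => x i `^ r^-1).

(** For k = C and c = 1 - C, the sign of this expression decides the two
    inequalities; k is kept free so that it can also be the extremal value, for
    which the expression has constant sign and a zero. *)
Definition defect {R : realType} {n : nat} (r alpha k c : R) (q x : 'I_n -> R) : R :=
  k * wsum q x `^ alpha + c * gmean q x `^ alpha - rmean r q x `^ (r * alpha).

Lemma gmean_ge0 (R : realType) (n : nat) (q x : 'I_n -> R) : 0 <= gmean q x.
Proof. by rewrite /gmean; apply: prodr_ge0 => i _; rewrite powR_ge0. Qed.

Section Scale.
Variables (R : realType) (n : nat) (r alpha k c : R) (q : 'I_n -> R).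
Hypotheses (r1 : 1 < r) (hq : admissible_weights q).

Let r0 : 0 < r. Proof. exact: lt_trans r1. Qed.

Lemma powR_sum (l : R) (f : 'I_n -> R) : 0 < l ->
  l `^ (\sum_(i < n) f i) = \prod_(i < n) l `^ f i.
Proof.
move=> l0; apply: (big_morph (powR l)); last by rewrite powRr0.
by move=> a b; rewrite powRD// (gt_eqF l0) implybT.
Qed.

Lemma gmean_scale (l : R) (x : 'I_n -> R) : 0 < l -> (forall i, 0 <= x i) ->
  gmean q (fun i => l * x i) = l * gmean q x.
Proof.
move=> l0 x0; rewrite /gmean.
under eq_bigr do rewrite powRM ?(ltW l0)//.
by rewrite big_split/= -powR_sum// (proj2 hq) powRr1// ltW.
Qed.

Lemma defect_scale (l : R) (x : 'I_n -> R) : 0 < l -> (forall i, 0 <= x i) ->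
  defect r alpha k c q (fun i => l * x i) = l `^ alpha * defect r alpha k c q x.
Proof.
move=> l0 x0; have q0 i : 0 <= q i := ltW (proj1 hq i).
rewrite /defect gmean_scale//.
have -> : wsum q (fun i => l * x i) = l * wsum q x.
  by rewrite /wsum mulr_sumr; apply: eq_bigr => i _; rewrite mulrCA.
have -> : rmean r q (fun i => l * x i) = l `^ r^-1 * rmean r q x.
  rewrite /rmean /wsum mulr_sumr; apply: eq_bigr => i _.
  by rewrite powRM ?(ltW l0)// mulrCA.
rewrite !powRM ?(ltW l0) ?powR_ge0//; first last.
- by apply: sumr_ge0 => i _; rewrite mulr_ge0.
- exact: gmean_ge0.
- by apply: sumr_ge0 => i _; rewrite mulr_ge0 ?powR_ge0.
have -> : (l `^ r^-1) `^ (r * alpha) = l `^ alpha.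
  by rewrite -powRrM mulrA mulVf ?gt_eqF// mul1r.
ring.
Qed.
End Scale.

(** Condition [0 <= p - w] keeps the base positive for every s: it equals
    (p - w) + w exp (d s). *)
Lemma is_derive_powR_mix (R : realType) (p w d b s : R) : 0 <= p - w -> 0 < w ->
  is_derive s 1 (fun s => (p + w * (expR (d * s) - 1)) `^ b)
    (b * (p + w * (expR (d * s) - 1)) `^ (b - 1) * (w * (d * expR (d * s)))).
Proof.
move=> pw w0.
apply: (@is_derive1_comp R (@powR R ^~ b) (fun s => p + w * (expR (d * s) - 1))).
  apply: is_derive1_powR.
  have -> : p + w * (expR (d * s) - 1) = (p - w) + w * expR (d * s) by ring.
  by rewrite ltr_wpDl// mulr_gt0 ?expR_gt0.
apply: is_derive_eq.
by rewrite /GRing.scale/= !mulr1 !add0r; ring.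
Qed.

(** Minimum and maximum are treated together, so that one stationarity equation
    serves both parts of the theorem. *)
Lemma derive_global_extremum (R : realType) (f df : R -> R) :
  (forall s : R, is_derive s 1 f (df s)) ->
  (forall s, f 0 <= f s) \/ (forall s, f s <= f 0) -> df 0 = 0.
Proof.
move=> D ext.
have N1 : -1 <= 1 :> R by lra.
have I0 : (0 : R) \in `]-1, 1[ by rewrite in_itv/=; apply/andP; split; lra.
have fd t : derivable f t 1 by case: (D t).
have d0 : is_derive (0 : R) 1 f 0.
  case: ext => ext.
    by apply: (@derive1_at_min R f (-1) 1 0 N1 (fun t _ => fd t) I0 (fun t _ => ext t)).
  by apply: (@derive1_at_max R f (-1) 1 0 N1 (fun t _ => fd t) I0 (fun t _ => ext t)).
by case: (D 0) => _ <-; case: d0.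
Qed.

Lemma extremal_expR_mix (R : realType) (k A0 p alpha g d m0 w e b : R) :
  0 <= A0 - p -> 0 < p -> 0 <= m0 - w -> 0 < w ->
  let phi := fun s => k * (A0 + p * (expR (1 * s) - 1)) `^ alpha + g * expR (d * s)
                   - (m0 + w * (expR (e * s) - 1)) `^ b in
  phi 0 = 0 -> (forall s, 0 <= phi s) \/ (forall s, phi s <= 0) ->
  k * (alpha * A0 `^ (alpha - 1) * p) + g * d = b * m0 `^ (b - 1) * (w * e).
Proof.
move=> Ap p0 mw w0 phi phi0 ext.
pose dphi s := k * (alpha * (A0 + p * (expR (1 * s) - 1)) `^ (alpha - 1) * (p * (1 * expR (1 * s))))
   + g * (d * expR (d * s)) - b * (m0 + w * (expR (e * s) - 1)) `^ (b - 1) * (w * (e * expR (e * s))).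
have D (s : R) : is_derive s 1 phi (dphi s).
  have D1 := @is_derive_powR_mix R A0 p 1 alpha s Ap p0.
  have D2 := @is_derive_powR_mix R m0 w e b s mw w0.
  rewrite /phi; apply: is_derive_eq.
  by rewrite /GRing.scale/= /dphi; ring.
have : dphi 0 = 0.
  apply: (@derive_global_extremum R phi dphi D).
  by rewrite phi0.
rewrite /dphi !mulr0 expR0 subrr !mulr0 !addr0 !mulr1 => /eqP.
by rewrite subr_eq0 => /eqP.
Qed.

Lemma powR_expRl (R : realType) (s y : R) : expR s `^ y = expR (y * s).
Proof. by rewrite /powR expR_eq0 expRK. Qed.

Section Stationary.
Variables (R : realType) (n : nat) (r alpha k c : R) (q x : 'I_n -> R).
Hypotheses (r1 : 1 < r) (al0 : 0 < alpha) (hq : admissible_weights q)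
  (x0 : forall i, 0 < x i).

Let q0 : forall i, 0 < q i. Proof. by case: hq. Qed.

Let pert (i : 'I_n) (s : R) : 'I_n -> R :=
  fun j => if j == i then x j * expR s else x j.

Lemma wsum_update (f g : 'I_n -> R) i : (forall j, j != i -> g j = f j) ->
  wsum q g = wsum q f + q i * (g i - f i).
Proof.
move=> gf; rewrite /wsum (bigD1 i)//= [in RHS](bigD1 i)//= (eq_bigr (fun j => q j * f j)); last first.
  by move=> j /gf ->.
ring.
Qed.

Lemma wsum_ge (f : 'I_n -> R) i : (forall j, 0 <= f j) -> q i * f i <= wsum q f.
Proof.
move=> f0; rewrite /wsum (bigD1 i)//= lerDl sumr_ge0// => j _.
by rewrite mulr_ge0// ltW.
Qed.

(** Multiplying the i-th coordinate by exp s preserves positivity for every s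
    and changes the three means by explicit exponentials, so the extremum
    condition is the vanishing of the derivative of a function of s. *)
Lemma defect_stationary : defect r alpha k c q x = 0 ->
  (forall y, (forall i, 0 < y i) -> 0 <= defect r alpha k c q y) \/
  (forall y, (forall i, 0 < y i) -> defect r alpha k c q y <= 0) ->
  forall i, k * wsum q x `^ (alpha - 1) * x i + c * gmean q x `^ alpha
            = rmean r q x `^ (r * alpha - 1) * x i `^ r^-1.
Proof.
move=> Fx ext i.
have r0 : 0 < r := lt_trans ltr01 r1.
have pert0 s j : 0 < pert i s j.
  by rewrite /pert; case: eqP; rewrite ?mulr_gt0 ?expR_gt0.
have defE s : defect r alpha k c q (pert i s) =
    k * (wsum q x + (q i * x i) * (expR (1 * s) - 1)) `^ alpha
    + (c * gmean q x `^ alpha) * expR ((q i * alpha) * s)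
    - (rmean r q x + (q i * x i `^ r^-1) * (expR (r^-1 * s) - 1)) `^ (r * alpha).
  rewrite /defect; congr (_ * _ `^ _ + _ - _ `^ _).
  - rewrite (wsum_update x _ i); last by rewrite /pert => j /negbTE ->.
    by rewrite /pert eqxx mul1r; ring.
  - rewrite -mulrA; congr (_ * _).
    have -> : gmean q (pert i s) = gmean q x * expR (q i * s).
      rewrite /gmean (bigD1 i)//= [in RHS](bigD1 i)//= {1}/pert eqxx powRM ?expR_ge0 ?ltW//.
      rewrite powR_expRl mulrAC; congr (_ * _ * _); apply: eq_bigr => j /negbTE.
      by rewrite /pert => ->.
    rewrite powRM ?gmean_ge0 ?expR_ge0// powR_expRl.
    by congr (_ * expR _); ring.
  - rewrite /rmean (wsum_update (fun j => x j `^ r^-1) _ i); last first.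
      by rewrite /pert => j /negbTE ->.
    rewrite /pert eqxx powRM ?expR_ge0 ?ltW// powR_expRl; ring.
have Ap := wsum_ge x i (fun j => ltW (x0 j)).
have mp := wsum_ge (fun j => x j `^ r^-1) i (fun j => powR_ge0 _ _).
rewrite -subr_ge0 in Ap; rewrite -subr_ge0 in mp.
have := @extremal_expR_mix R k (wsum q x) (q i * x i) alpha
  (c * gmean q x `^ alpha) (q i * alpha) (rmean r q x) (q i * x i `^ r^-1) r^-1
  (r * alpha) Ap (mulr_gt0 (q0 i) (x0 i)) mp (mulr_gt0 (q0 i) (powR_gt0 _ (x0 i))).
move=> /= h.
have /h{h} : k * (wsum q x + q i * x i * (expR (1 * 0) - 1)) `^ alpha +
    c * gmean q x `^ alpha * expR (q i * alpha * 0) -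
    (rmean r q x + q i * x i `^ r^-1 * (expR (r^-1 * 0) - 1)) `^ (r * alpha) = 0.
  by rewrite !mulr0 expR0 subrr !mulr0 !addr0 mulr1.
move=> h.
have qa : q i * alpha != 0 by rewrite mulf_neq0 ?gt_eqF.
have rr : r != 0 by rewrite gt_eqF.
apply: (mulfI qa).
transitivity (k * (alpha * wsum q x `^ (alpha - 1) * (q i * x i)) +
    c * gmean q x `^ alpha * (q i * alpha)); first by ring.
rewrite h; first by field.
by case: ext => ext; [left|right] => s; rewrite -defE; exact: ext.
Qed.
End Stationary.

(** * At most two distinct values at an extremum *)

(** The tangent at y2 lies strictly below the graph at y1 and at y3, so the slope
    d / K would be both smaller and larger than that of the tangent. *)
Lemma line_meets_powR_twice (R : realType) (r K c d y1 y2 y3 : R) :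
  1 < r -> 0 < K -> 0 <= y1 -> y1 < y2 -> y2 < y3 ->
  K * y1 `^ r + c = d * y1 -> K * y2 `^ r + c = d * y2 ->
  K * y3 `^ r + c = d * y3 -> False.
Proof.
move=> r1 K0 y10 y12 y23 e1 e2 e3.
have y20 : 0 < y2 := le_lt_trans y10 y12.
have := @powR_gt_tangent R r y1 y2 r1 y10 y20; rewrite lt_eqF// => /(_ isT).
have := @powR_gt_tangent R r y3 y2 r1 (ltW (lt_trans y20 y23)) y20.
rewrite gt_eqF// => /(_ isT).
set S := r * _; rewrite -(ltr_pM2l K0) => h3; rewrite -(ltr_pM2l K0) => h1.
have {h3} : 0 < (d - K * S) * (y3 - y2).
  move: h3; rewrite mulrDr; have -> : K * y3 `^ r = d * y3 - c by rewrite -e3; ring.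
  have -> : K * y2 `^ r = d * y2 - c by rewrite -e2; ring.
  rewrite -subr_gt0; congr (0 < _); ring.
have {h1} : 0 < (d - K * S) * (y1 - y2).
  move: h1; rewrite mulrDr; have -> : K * y1 `^ r = d * y1 - c by rewrite -e1; ring.
  have -> : K * y2 `^ r = d * y2 - c by rewrite -e2; ring.
  rewrite -subr_gt0; congr (0 < _); ring.
rewrite nmulr_lgt0 ?subr_lt0// => h; rewrite pmulr_lgt0 ?subr_gt0// => h'.
by move: (lt_trans h h'); rewrite ltxx.
Qed.

Section Reduction.
Variables (R : realType) (n : nat) (r alpha k c w : R) (q x : 'I_n -> R).
Hypotheses (r1 : 1 < r) (al0 : 0 < alpha) (hq : admissible_weights q)
  (w0 : 0 < w) (wq : forall i, w <= q i) (x0 : forall i, 0 < x i).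

Let q0 : forall i, 0 < q i. Proof. by case: hq. Qed.
Let r0 : 0 < r. Proof. exact: lt_trans r1. Qed.

Let y i := x i `^ r^-1.

Let xE i : x i = y i `^ r.
Proof. by rewrite /y -powRrM mulVf ?gt_eqF// powRr1// ltW. Qed.

Let y0 i : 0 < y i. Proof. exact: powR_gt0. Qed.

Let y_lt i j : x i < x j -> y i < y j.
Proof. by move=> h; rewrite gt0_ltr_powR ?invr_gt0// nnegrE ltW. Qed.

Lemma wsum_two_values (i j : 'I_n) (f : 'I_n -> R) :
  (forall l, x l == x j -> f l = f j) -> (forall l, x l != x j -> f l = f i) ->
  let Q := \sum_(l < n | x l == x j) q l in
  wsum q f = Q * f j + (1 - Q) * f i.
Proof.
move=> fj fi Q.
have -> : 1 - Q = \sum_(l < n | x l != x j) q l.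
  by apply/eqP; rewrite subr_eq -(proj2 hq) (bigID (fun l => x l == x j))/= addrC.
rewrite /wsum (bigID (fun l => x l == x j))/= /Q !mulr_suml.
by congr (_ + _); apply: eq_bigr => l h; rewrite ?(fj _ h) ?(fi _ h).
Qed.

(** With y_i < y_j the least and the greatest y, any further value would be a
    third root of the stationarity equation.  Subtracting the equations at i
    and at j removes G, and factoring x_j out of A and y_j out of m leaves a
    relation between Q and t = y_i / y_j only.  When all coordinates agree,
    A = G = M and the vanishing of the defect determines k. *)
Lemma critical_point_two_values (i0 : 'I_n) : defect r alpha k c q x = 0 ->
  (forall i, k * wsum q x `^ (alpha - 1) * x i + c * gmean q x `^ alpha
            = rmean r q x `^ (r * alpha - 1) * x i `^ r^-1) ->
  k = 1 - c \/ exists Q t, [/\ 0 < t < 1, 0 < Q < 1, w <= Q, w <= 1 - Q &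
    k * ((Q + (1 - Q) * t `^ r) `^ (alpha - 1) * (1 - t `^ r))
     = (Q + (1 - Q) * t) `^ (r * alpha - 1) * (1 - t)].
Proof.
move=> Fx st.
case: (@Order.TotalTheory.arg_minP _ _ _ i0 predT x) => // i _ imin.
case: (@Order.TotalTheory.arg_maxP _ _ _ i0 predT x) => // j _ jmax.
have wsum_gt0 (f : 'I_n -> R) : (forall l, 0 < f l) -> 0 < wsum q f.
  move=> f0; rewrite /wsum (bigD1 i0)//= ltr_pwDl ?mulr_gt0// sumr_ge0// => l _.
  by rewrite mulr_ge0// ltW.
have [xij|xij] := leP (x j) (x i).
  left; have xE' l : x l = x j.
    apply/le_anti/andP; split; first exact: jmax.
    by apply: le_trans xij _; apply: imin.
  have wE (f : 'I_n -> R) v : (forall l, f l = v) -> wsum q f = v.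
    move=> fv; rewrite /wsum; under eq_bigr do rewrite fv.
    by rewrite -mulr_suml (proj2 hq) mul1r.
  have gE : gmean q x = x j.
    rewrite /gmean; under eq_bigr do rewrite xE'.
    by rewrite -powR_sum// (proj2 hq) powRr1// ltW.
  move: Fx; rewrite /defect gE (wE x (x j))// /rmean (wE _ (y j)); last first.
    by move=> l; rewrite /y xE'.
  rewrite powRrM -xE => /eqP; rewrite -mulrDl -[X in _ - X]mul1r -mulrBl.
  rewrite mulf_eq0 [_ `^ _ == _]gt_eqF ?powR_gt0// orbF => /eqP h; lra.
right; set Q := \sum_(l < n | x l == x j) q l; exists Q, (y i / y j).
set A' := wsum q x `^ (alpha - 1) in st.
set m' := rmean r q x `^ (r * alpha - 1) in st.
have A'0 : 0 < A' by rewrite powR_gt0// wsum_gt0.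
have m'0 : 0 < m' by rewrite powR_gt0// wsum_gt0.
have yij := y_lt _ _ xij.
have slope : k * A' * (x j - x i) = m' * (y j - y i).
  have := st i; have := st j; rewrite -/(y i) -/(y j) !mulrBr => <- <-; ring.
have kA : 0 < k * A'.
  have : 0 < k * A' * (x j - x i) by rewrite slope mulr_gt0 ?subr_gt0.
  by rewrite pmulr_lgt0 ?subr_gt0.
have two l : x l != x j -> x l = x i.
  move=> lj; apply/eqP; case: eqP => // /eqP li; exfalso.
  have yil : y i < y l by apply: y_lt; rewrite lt_neqAle eq_sym li; exact: imin.
  have ylj : y l < y j by apply: y_lt; rewrite lt_neqAle lj; exact: jmax.
  by apply: (@line_meets_powR_twice R r (k * A') (c * gmean q x `^ alpha) m'
    (y i) (y l) (y j)) => //; rewrite ?ltW// -xE; exact: st.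
have wx : wsum q x = Q * x j + (1 - Q) * x i.
  by apply: wsum_two_values => l => [/eqP|/two].
have wy : rmean r q x = Q * y j + (1 - Q) * y i.
  by apply: (wsum_two_values i j y) => l => [/eqP|/two]; rewrite /y => ->.
have wQ : w <= Q.
  rewrite /Q (bigD1 j)//= (le_trans (wq j))// lerDl sumr_ge0// => l _.
  exact: ltW.
have wQ' : w <= 1 - Q.
  have -> : 1 - Q = \sum_(l < n | x l != x j) q l.
    by apply/eqP; rewrite subr_eq -(proj2 hq) (bigID (fun l => x l == x j))/= addrC.
  rewrite (bigD1 i)/=; last by rewrite lt_eqF.
  by rewrite (le_trans (wq i))// lerDl sumr_ge0// => l _; exact: ltW.
have Q0 : 0 < Q := lt_le_trans w0 wQ.
have Q1 : 0 < 1 - Q := lt_le_trans w0 wQ'.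
split=> //.
- by rewrite divr_gt0// ltr_pdivrMr// mul1r.
- by rewrite Q0 -subr_gt0.
have tu : (y i / y j) `^ r = x i / x j.
  rewrite powRM ?invr_ge0 ?ltW// -xE; congr (_ * _).
  by rewrite -powR_inv1 ?(ltW (y0 j))// -powRrM mulN1r powRN -xE.
have xj0 : x j != 0 by rewrite gt_eqF.
have yj0 : y j != 0 by rewrite gt_eqF.
rewrite tu.
have eA : A' * (x j - x i) = x j `^ alpha *
    ((Q + (1 - Q) * (x i / x j)) `^ (alpha - 1) * (1 - x i / x j)).
  rewrite /A' wx (_ : _ + _ = x j * (Q + (1 - Q) * (x i / x j))); last by field.
  rewrite powRM ?(ltW (x0 j))//; last first.
    by rewrite addr_ge0 ?mulr_ge0 ?invr_ge0 ?ltW.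
  by rewrite -(mulr_powRB1 (ltW (x0 j)) al0); field.
have ra0 : 0 < r * alpha by rewrite mulr_gt0.
have eM : m' * (y j - y i) = x j `^ alpha *
    ((Q + (1 - Q) * (y i / y j)) `^ (r * alpha - 1) * (1 - y i / y j)).
  rewrite /m' wy (_ : _ + _ = y j * (Q + (1 - Q) * (y i / y j))); last by field.
  rewrite powRM ?(ltW (y0 j))//; last first.
    by rewrite addr_ge0 ?mulr_ge0 ?invr_ge0 ?ltW.
  rewrite (xE j) -powRrM -(mulr_powRB1 (ltW (y0 j)) ra0); by field.
have xa : x j `^ alpha != 0 by rewrite gt_eqF ?powR_gt0.
by apply: (mulfI xa); rewrite -eM -slope mulrCA -eA mulrA.
Qed.
End Reduction.

(** * Comparison of the means *)

(** Jensen's inequality for s |-> s^r and weights of arbitrary total S, obtained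
    by summing the tangent line inequality at the mean m / S. *)
Lemma powR_sum_tangent (R : realType) (n : nat) (P : pred 'I_n) (r : R)
    (q y : 'I_n -> R) :
  1 < r -> (forall i, 0 <= q i) -> (forall i, 0 <= y i) ->
  0 < \sum_(i < n | P i) q i ->
  (\sum_(i < n | P i) q i * y i) `^ r
    <= (\sum_(i < n | P i) q i) `^ (r - 1) * \sum_(i < n | P i) q i * y i `^ r.
Proof.
move=> r1 q0 y0.
set S := \sum_(i < n | P i) q i; set m := \sum_(i < n | P i) q i * y i => S0.
have r0 : 0 < r := lt_trans ltr01 r1.
have m0 : 0 <= m by apply: sumr_ge0 => i _; rewrite mulr_ge0.
move: m0; rewrite le_eqVlt => /orP[/eqP<-|m0].
  rewrite powR0 ?gt_eqF// mulr_ge0 ?powR_ge0//.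
  by apply: sumr_ge0 => i _; rewrite mulr_ge0 ?powR_ge0.
have mu0 : 0 < m / S by rewrite divr_gt0.
have tan : S * (m / S) `^ r <= \sum_(i < n | P i) q i * y i `^ r.
  have -> : S * (m / S) `^ r = \sum_(i < n | P i)
      q i * ((m / S) `^ r + r * (m / S) `^ (r - 1) * (y i - m / S)).
    have E : \sum_(i < n | P i) q i * (y i - m / S) = 0.
      under eq_bigr do rewrite mulrBr.
      rewrite sumrB -mulr_suml -/S -/m mulrCA divff ?mulr1 ?subrr//.
      by rewrite gt_eqF.
    under [RHS]eq_bigr do rewrite mulrDr mulrCA.
    by rewrite big_split/= -mulr_suml -mulr_sumr E mulr0 addr0.
  by apply: ler_sum => i _; rewrite ler_wpM2l// powR_ge_tangent.
rewrite (_ : m `^ r = S `^ (r - 1) * (S * (m / S) `^ r)).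
  by rewrite ler_wpM2l// powR_ge0.
rewrite mulrA [S `^ _ * S]mulrC mulr_powRB1 ?(ltW S0)//.
by rewrite -powRM ?(ltW S0) ?(ltW mu0)// mulrCA divff ?mulr1// gt_eqF.
Qed.

Section Means.
Variables (R : realType) (n : nat) (r : R) (q x : 'I_n -> R).
Hypotheses (r1 : 1 < r) (hq : admissible_weights q) (x0 : forall i, 0 <= x i).

Let q0 : forall i, 0 < q i. Proof. by case: hq. Qed.
Let r0 : 0 < r. Proof. exact: lt_trans r1. Qed.

Let xE i : x i = (x i `^ r^-1) `^ r.
Proof. by rewrite -powRrM mulVf ?gt_eqF// powRr1. Qed.

Lemma rmean_ge0 : 0 <= rmean r q x.
Proof. by apply: sumr_ge0 => i _; rewrite mulr_ge0 ?powR_ge0// ltW. Qed.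

(** Jensen's inequality over the coordinates other than k, whose total weight is
    1 - q_k <= 1 - w. *)
Lemma rmean_vanishing_coord w k : 0 < w -> w <= q k -> w <= 1 - q k -> x k = 0 ->
  rmean r q x `^ r <= (1 - w) `^ (r - 1) * wsum q x.
Proof.
move=> w0 wk wk' xk.
have S : \sum_(i < n | i != k) q i = 1 - q k.
  by apply/eqP; rewrite eq_sym subr_eq -(proj2 hq) (bigD1 k)//= addrC.
have := @powR_sum_tangent R n (fun i => i != k) r q (fun i => x i `^ r^-1) r1
  (fun i => ltW (q0 i)) (fun i => powR_ge0 _ _).
rewrite S => /(_ (lt_le_trans w0 wk')).
have -> : \sum_(i < n | i != k) q i * x i `^ r^-1 = rmean r q x.
  by rewrite /rmean /wsum [RHS](bigD1 k)//= xk powR0 ?invr_eq0 ?gt_eqF// mulr0 add0r.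
have -> : \sum_(i < n | i != k) q i * (x i `^ r^-1) `^ r = wsum q x.
  rewrite /wsum [RHS](bigD1 k)//= xk mulr0 add0r.
  by apply: eq_bigr => i _; rewrite -xE.
move=> h; apply: (le_trans h); rewrite ler_wpM2r//.
  by apply: sumr_ge0 => i _; rewrite mulr_ge0// ltW.
have k1 : 0 <= 1 - q k by rewrite (le_trans (ltW w0)).
by rewrite ge0_ler_powR ?nnegrE ?subr_ge0 ?(ltW r1)//; lra.
Qed.

(** Each q_i x_i = q_i y_i y_i^(r - 1), and w y_i <= q_i y_i <= m. *)
Lemma rmean_superadditive w : 0 <= w -> (forall i, w <= q i) ->
  w `^ (r - 1) * wsum q x <= rmean r q x `^ r.
Proof.
move=> w0 wq; rewrite -(mulr_powRB1 rmean_ge0 r0) {1}/rmean /wsum mulr_sumr mulr_suml.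
apply: ler_sum => i _.
rewrite [in leLHS](xE i) -(@mulr_powRB1 _ (x i `^ r^-1) r (powR_ge0 _ _) r0).
rewrite mulrC -!mulrA ler_wpM2l ?(ltW (q0 i))// ler_wpM2l ?powR_ge0//.
rewrite -powRM ?powR_ge0//.
have h : x i `^ r^-1 * w <= rmean r q x.
  apply: le_trans (@wsum_ge _ _ q hq (fun i => x i `^ r^-1) i _); last first.
    by move=> j; rewrite powR_ge0.
  by rewrite mulrC ler_wpM2r ?powR_ge0.
apply: ge0_ler_powR => //; rewrite ?subr_ge0 ?(ltW r1) ?nnegrE ?rmean_ge0//.
by rewrite mulr_ge0 ?powR_ge0.
Qed.

Lemma rmean_lt_wsum i j : x i < x j -> rmean r q x `^ r < wsum q x.
Proof.
move=> xij; set m := rmean r q x.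
have yj : 0 < x j `^ r^-1 by rewrite powR_gt0// (le_lt_trans (x0 i)).
have m0 : 0 < m.
  apply: lt_le_trans (@wsum_ge _ _ q hq (fun i => x i `^ r^-1) j _).
    by rewrite mulr_gt0.
  by move=> l; rewrite powR_ge0.
have [k km] : exists k, x k `^ r^-1 != m.
  have [ei|] := eqVneq (x i `^ r^-1) m; last by exists i.
  exists j; rewrite -ei; apply: contraTneq xij => e.
  by rewrite [x i]xE [x j]xE e ltxx.
have -> : m `^ r = \sum_(l < n)
    q l * (m `^ r + r * m `^ (r - 1) * (x l `^ r^-1 - m)).
  have E : \sum_(l < n) q l * (x l `^ r^-1 - m) = 0.
    under eq_bigr do rewrite mulrBr.
    by rewrite sumrB -mulr_suml (proj2 hq) mul1r subrr.
  under [RHS]eq_bigr do rewrite mulrDr mulrCA.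
  by rewrite big_split/= -mulr_suml -mulr_sumr E mulr0 addr0 (proj2 hq) mul1r.
rewrite /wsum (bigD1 k)//= [ltRHS](bigD1 k)//=.
apply: ltr_leD.
  by rewrite ltr_pM2l// [ltRHS]xE powR_gt_tangent ?powR_ge0.
apply: ler_sum => l _.
by rewrite ler_pM2l// [leRHS]xE powR_ge_tangent ?powR_ge0.
Qed.

(** Each factor satisfies (x_i / A)^q_i <= exp (q_i (x_i / A - 1)), and the
    exponents sum to 0. *)
Lemma gmean_le_wsum : 0 < wsum q x -> gmean q x <= wsum q x.
Proof.
move=> A0; set A := wsum q x in A0 *.
have -> : A = \prod_(i < n) (A `^ q i * expR (q i * (x i / A - 1))).
  rewrite big_split/= -powR_sum// (proj2 hq) powRr1 ?(ltW A0)//.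
  rewrite -expR_sum.
  under eq_bigr do rewrite mulrBr mulr1 mulrA.
  rewrite sumrB -mulr_suml -/(wsum q x) -/A divff ?gt_eqF// (proj2 hq) subrr.
  by rewrite expR0 mulr1.
apply: ler_prod => i _; rewrite powR_ge0/=.
have -> : x i `^ q i = A `^ q i * (x i / A) `^ q i.
  by rewrite -powRM ?(ltW A0) ?divr_ge0 ?(ltW A0)// mulrCA divff ?mulr1// gt_eqF.
rewrite ler_wpM2l ?powR_ge0// -powR_expRl ge0_ler_powR ?(ltW (q0 i))//.
- by rewrite nnegrE divr_ge0// ltW.
- by rewrite nnegrE expR_ge0.
by have := expR_ge1Dx (x i / A - 1); rewrite addrC subrK.
Qed.
End Means.

(** * The extremal value *)

Section Extremal.
Variables (R : realType) (n : nat) (r alpha w : R) (q : 'I_n -> R).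
Hypotheses (r1 : 1 < r) (al0 : 0 < alpha) (hq : admissible_weights q)
  (w0 : 0 < w) (wq : forall i, w <= q i).

Let q0 : forall i, 0 < q i. Proof. by case: hq. Qed.
Let r0 : 0 < r. Proof. exact: lt_trans r1. Qed.

Let K c (x : 'I_n -> R) := rmean r q x `^ (r * alpha) - c * gmean q x `^ alpha.

Let K_continuous c : continuous (fun v : 'rV[R]_n => K c (fun i => `|v ord0 i|)).
Proof.
have -> : (fun v : 'rV[R]_n => K c (fun i => `|v ord0 i|)) =
    (fun v => `|\sum_(i < n) q i * `|v ord0 i| `^ r^-1| `^ (r * alpha)
            - c * `|\prod_(i < n) `|v ord0 i| `^ q i| `^ alpha).
  apply/funext => v; rewrite /K; congr (_ `^ _ - _ * _ `^ _).
    by rewrite ger0_norm//; apply: rmean_ge0.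
  by rewrite ger0_norm//; apply: gmean_ge0.
have c1 (p : R) : 0 < p -> continuous (fun z : R => `|z| `^ p) by exact: continuous_powR_norm.
have cA : continuous (fun v : 'rV[R]_n =>
    `|\sum_(i < n) q i * `|v ord0 i| `^ r^-1| `^ (r * alpha)).
  move=> v; apply: (@continuous_comp _ _ _
    (fun v : 'rV[R]_n => \sum_(i < n) q i * `|v ord0 i| `^ r^-1)
    (fun z : R => `|z| `^ (r * alpha))); last by apply: c1; rewrite mulr_gt0.
  apply: (@continuous_sum_coord R n (fun i z => q i * `|z| `^ r^-1)) => i z.
  by apply: cvgM; [exact: cvg_cst | apply: c1; rewrite invr_gt0].
have cG : continuous (fun v : 'rV[R]_n =>
    `|\prod_(i < n) `|v ord0 i| `^ q i| `^ alpha).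
  move=> v; apply: (@continuous_comp _ _ _
    (fun v : 'rV[R]_n => \prod_(i < n) `|v ord0 i| `^ q i)
    (fun z : R => `|z| `^ alpha)); last exact: c1.
  by apply: (@continuous_prod_coord R n (fun i z => `|z| `^ q i)) => i z; exact: c1.
by move=> v; exact: (cvgB (cA v) (cvgM (cvg_cst c) (cG v))).
Qed.

Let defectK k c x : wsum q x = 1 -> defect r alpha k c q x = k - K c x.
Proof. by move=> x1; rewrite /defect x1 powR1 /K; ring. Qed.

Lemma defect_normalize k c x : 0 < wsum q x -> (forall i, 0 <= x i) ->
  exists y, [/\ forall i, 0 <= y i, wsum q y = 1 &
    defect r alpha k c q x = wsum q x `^ alpha * defect r alpha k c q y].
Proof.
move=> A0 x0; exists (fun i => x i / wsum q x); split.
- by move=> i; rewrite divr_ge0 ?(ltW A0).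
- rewrite {1}/wsum; under eq_bigr do rewrite mulrA.
  by rewrite -mulr_suml -/(wsum q x) divff// lt0r_neq0.
have xA0 i : 0 <= x i / wsum q x by rewrite divr_ge0 ?(ltW A0).
rewrite -(@defect_scale R n r alpha k c q r1 hq _ _ A0 xA0).
congr (defect r alpha k c q _); apply/funext => i.
by rewrite mulrCA divff ?mulr1// lt0r_neq0.
Qed.

Let pos_wsum x : 'I_n -> (forall i, 0 < x i) -> 0 < wsum q x.
Proof.
move=> i x0; apply: lt_le_trans (wsum_ge _ _ q hq x i (fun j => ltW (x0 j))).
exact: mulr_gt0.
Qed.

(** By homogeneity, an extremum on the simplex makes the defect with
    k = K c x of constant sign on all positive points, which frees the
    variations from the constraint. *)
Lemma extremal_value_two_point (i0 : 'I_n) c x : (forall i, 0 < x i) -> wsum q x = 1 ->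
  (forall y, (forall i, 0 <= y i) -> wsum q y = 1 -> K c y <= K c x) \/
  (forall y, (forall i, 0 <= y i) -> wsum q y = 1 -> K c x <= K c y) ->
  K c x = 1 - c \/ exists Q t, [/\ 0 < t < 1, 0 < Q < 1, w <= Q, w <= 1 - Q &
    K c x * ((Q + (1 - Q) * t `^ r) `^ (alpha - 1) * (1 - t `^ r))
     = (Q + (1 - Q) * t) `^ (r * alpha - 1) * (1 - t)].
Proof.
move=> x0 x1 ext.
have Fx : defect r alpha (K c x) c q x = 0 by rewrite defectK// subrr.
apply: (@critical_point_two_values R n r alpha (K c x) c w q x) => //.
apply: defect_stationary => //.
case: ext => ext; [left|right] => y y0;
  have [z [z0 z1 ->]] := defect_normalize (K c x) c y (pos_wsum y i0 y0) (fun i => ltW (y0 i)).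
  by rewrite mulr_ge0 ?powR_ge0// defectK// subr_ge0 ext.
by rewrite mulr_ge0_le0 ?powR_ge0// defectK// subr_le0 ext.
Qed.

Let gmean_zero x k : x k = 0 -> gmean q x = 0.
Proof.
by move=> xk; rewrite /gmean (bigD1 k)//= xk powR0 ?gt_eqF// mul0r.
Qed.

Let zero_coord (x : 'I_n -> R) : (forall i, 0 <= x i) ->
  (forall i, 0 < x i) \/ exists k, x k = 0.
Proof.
move=> x0; have [h|h] := pselect (exists k, x k = 0); first by right.
left=> i; rewrite lt_neqAle x0 andbT eq_sym.
by apply/eqP => e; apply: h; exists i.
Qed.

Let denom_gt0 Q t : 0 < t < 1 -> 0 < Q < 1 ->
  0 < (Q + (1 - Q) * t `^ r) `^ (alpha - 1) * (1 - t `^ r).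
Proof.
move=> t01 /andP[Q0 Q1]; rewrite mulr_gt0 ?powR_gt0//.
  by rewrite ltr_pwDl// mulr_ge0 ?powR_ge0// subr_ge0 ltW.
by case/andP: (t01) => _ t1; rewrite subr_gt0 (lt_trans (powR_lt_id _ _ _ r1 t01)).
Qed.

(** The value of K at a maximum on the simplex is at most C: by the first
    hypothesis if some coordinate vanishes, and otherwise because it is either C
    or a two-point value. *)
Lemma defect_ge0 (i0 : 'I_n) (C : R) :
  (forall x k, (forall i, 0 <= x i) -> x k = 0 ->
     rmean r q x `^ (r * alpha) <= C * wsum q x `^ alpha) ->
  (forall Q t, 0 < t < 1 -> 0 < Q < 1 -> w <= Q -> w <= 1 - Q ->
     (Q + (1 - Q) * t) `^ (r * alpha - 1) * (1 - t) <=
     C * ((Q + (1 - Q) * t `^ r) `^ (alpha - 1) * (1 - t `^ r))) ->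
  forall x, 0 < wsum q x -> (forall i, 0 <= x i) ->
  0 <= defect r alpha C (1 - C) q x.
Proof.
move=> bd tp x A0 x0.
have [y [y0 y1 ->]] := defect_normalize C (1 - C) x A0 x0.
rewrite mulr_ge0 ?powR_ge0// defectK// subr_ge0.
have [z [z0 z1 zmax]] := @simplex_max R n q (K (1 - C)) hq (K_continuous _).
apply: (le_trans (zmax y y0 y1)).
case: (zero_coord z z0) => [zp|[k zk]]; last first.
  have := bd z k z0 zk; rewrite z1 powR1 mulr1; apply: le_trans.
  by rewrite /K (gmean_zero z k zk) powR0 ?gt_eqF// mulr0 subr0.
have [|->|] := extremal_value_two_point i0 (1 - C) z zp z1; first by left.
  by rewrite opprB addrC subrK.
move=> [Q [t [t01 Q01 wQ wQ' E]]].
by rewrite -(ler_pM2r (denom_gt0 Q t t01 Q01)) E tp.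
Qed.

(** Dual to [defect_ge0], at a minimum on the simplex. *)
Lemma defect_le0 (i0 : 'I_n) (C : R) :
  (forall x k, (forall i, 0 <= x i) -> x k = 0 ->
     C * wsum q x `^ alpha <= rmean r q x `^ (r * alpha)) ->
  (forall Q t, 0 < t < 1 -> 0 < Q < 1 -> w <= Q -> w <= 1 - Q ->
     C * ((Q + (1 - Q) * t `^ r) `^ (alpha - 1) * (1 - t `^ r)) <=
     (Q + (1 - Q) * t) `^ (r * alpha - 1) * (1 - t)) ->
  forall x, 0 < wsum q x -> (forall i, 0 <= x i) ->
  defect r alpha C (1 - C) q x <= 0.
Proof.
move=> bd tp x A0 x0.
have [y [y0 y1 ->]] := defect_normalize C (1 - C) x A0 x0.
rewrite mulr_ge0_le0 ?powR_ge0// defectK// subr_le0.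
have NK : continuous (fun v : 'rV[R]_n => - K (1 - C) (fun i => `|v ord0 i|)).
  by move=> v; exact: (cvgN (K_continuous (1 - C) v)).
have [z [z0 z1 zmax]] := @simplex_max R n q (fun x => - K (1 - C) x) hq NK.
have zmin s : (forall i, 0 <= s i) -> wsum q s = 1 -> K (1 - C) z <= K (1 - C) s.
  by move=> s0 s1; rewrite -lerN2 zmax.
apply: (le_trans _ (zmin y y0 y1)).
case: (zero_coord z z0) => [zp|[k zk]]; last first.
  have := bd z k z0 zk; rewrite z1 powR1 mulr1 => h; apply: (le_trans h).
  by rewrite /K (gmean_zero z k zk) powR0 ?gt_eqF// mulr0 subr0.
have [|->|] := extremal_value_two_point i0 (1 - C) z zp z1; first by right.
  by rewrite opprB addrC subrK.
move=> [Q [t [t01 Q01 wQ wQ' E]]].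
by rewrite -(ler_pM2r (denom_gt0 Q t t01 Q01)) E tp.
Qed.
End Extremal.

(** * Admissible weights and points *)

Section Admissible.
Variables (R : realType) (n : nat) (q x : 'I_n -> R).
Hypotheses (n2 : (2 <= n)%N) (hq : admissible_weights q) (hx : admissible_points x).

Let q0 : forall i, 0 < q i. Proof. by case: hq. Qed.

Lemma min_weight_le i : min_weight q <= q i.
Proof. by rewrite /min_weight bigmin_le. Qed.

Lemma min_weight_gt0 : 0 < min_weight q.
Proof. by apply: lt_bigmin. Qed.

Lemma two_coords : exists i j : 'I_n, x i < x j /\ i != j.
Proof.
have n1 : (0 < n)%N by exact: ltn_trans n2.
exists (Ordinal n1), (Ordinal n2); split => //.
by case: hx => _; apply.
Qed.

Lemma min_weight_lt1 : min_weight q < 1.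
Proof.
have [i [j [_ ij]]] := two_coords.
apply: (le_lt_trans (min_weight_le i)).
rewrite -(proj2 hq) (bigD1 i)//= ltrDl (bigD1 j)/=; last by rewrite eq_sym.
by rewrite ltr_pwDl// sumr_ge0// => l _; rewrite ltW.
Qed.

Lemma min_weight_compl k : min_weight q <= 1 - q k.
Proof.
have [j jk] : exists j, j != k.
  have [i [j [_ ij]]] := two_coords.
  have [e|h] := eqVneq i k; last by exists i.
  by exists j; rewrite -e eq_sym.
rewrite -(proj2 hq) (bigD1 k)//= addrC addrK (bigD1 j)//=.
by rewrite (le_trans (min_weight_le j))// lerDl sumr_ge0// => l _; rewrite ltW.
Qed.

Lemma wsum_gt0 : 0 < wsum q x.
Proof.
have [x0 _] := hx; have [i [j [xij _]]] := two_coords.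
apply: lt_le_trans (@wsum_ge _ _ q hq x j x0).
by rewrite mulr_gt0// (le_lt_trans (x0 i)).
Qed.

Lemma mean_ratioE (r alpha : R) : 1 < r -> mean_ratio r alpha x q =
  `| (wsum q x `^ alpha - gmean q x `^ alpha)
     / (wsum q x `^ alpha - rmean r q x `^ (r * alpha)) |.
Proof.
move=> r1; have [x0 _] := hx.
have r0 : 0 < r := lt_trans ltr01 r1.
have -> : wsum q x = arith_mean x q.
  rewrite /arith_mean /power_mean oner_eq0 invr1 powRr1.
    by apply: eq_bigr => i _; rewrite powRr1.
  by apply: sumr_ge0 => i _; rewrite mulr_ge0 ?powR_ge0 ?(ltW (q0 i)).
have -> : gmean q x = geom_mean x q by rewrite /geom_mean /power_mean eqxx.
rewrite /mean_ratio; congr (`|_ / (_ - _)|).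
by rewrite /power_mean invr_eq0 gt_eqF// invrK powRrM.
Qed.
End Admissible.

(** * The two bounds on the ratio *)

Lemma powR_lt1 (R : realType) (w e : R) : 0 < w < 1 -> 0 < e -> w `^ e < 1.
Proof.
move=> /andP[w0 w1] e0.
by rewrite -[ltRHS](congr1 (fun f => f e) (@powR1 R)) gt0_ltr_powR// nnegrE ltW.
Qed.

Theorem theorem1p1 (R : realType) (r : R) (hr : 1 < r) :
  (r <= 2 ->
    forall a : R, 0 < a -> a <= min_a r ->
    forall (n : nat) (q x : 'I_n -> R), (2 <= n)%N ->
      admissible_weights q -> admissible_points x ->
      mean_ratio r (1 + a) x q
        <= 1 / (1 - (1 - min_weight q) `^ ((1 + a) * (r - 1))))
  /\
  (2 <= r ->
    forall a : R, 0 < a -> a < 1 -> a <= Num.min (1 - 1 / r) (min_a r) ->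
    forall (n : nat) (q x : 'I_n -> R), (2 <= n)%N ->
      admissible_weights q -> admissible_points x ->
      1 / (1 - min_weight q `^ ((1 - a) * (r - 1)))
        <= mean_ratio r (1 - a) x q).
Proof.
have r0 : 0 < r := lt_trans ltr01 hr.
have r10 : 0 < r - 1 by rewrite subr_gt0.
split=> r2 a a0.
- move=> am n q x n2 hq hx; have [x0 _] := hx.
  set w := min_weight q; set alpha := 1 + a.
  have w0 : 0 < w := min_weight_gt0 _ _ _ hq.
  have w1 : w < 1 := min_weight_lt1 _ _ _ _ n2 hq hx.
  have al1 : 1 <= alpha by rewrite lerDl ltW.
  have al0 : 0 < alpha := lt_le_trans ltr01 al1.
  set C := (1 - w) `^ (alpha * (r - 1)).
  have C1 : C < 1.
    by rewrite powR_lt1 ?mulr_gt0//; apply/andP; split; lra.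
  have A0 := wsum_gt0 _ _ _ _ n2 hq hx.
  have main : 0 <= defect r alpha C (1 - C) q x.
    apply: (@defect_ge0 R n r alpha w q) => //.
    - exact: min_weight_le.
    - exact: (Ordinal n2).
    - move=> z k z0 zk; rewrite /C [alpha * _]mulrC !powRrM -powRM ?powR_ge0//; last first.
        by apply: sumr_ge0 => i _; rewrite mulr_ge0// ltW// (proj1 hq).
      rewrite ge0_ler_powR ?nnegrE ?powR_ge0 ?(ltW al0)//.
        rewrite mulr_ge0 ?powR_ge0//.
        by apply: sumr_ge0 => i _; rewrite mulr_ge0// ltW// (proj1 hq).
      apply: (@rmean_vanishing_coord R n r q z hr hq z0 w k) => //.
        exact: min_weight_le.
      exact: (min_weight_compl _ _ _ _ n2 hq hx).
    - move=> Q t t01 Q01 wQ wQ'; apply: two_point_upper => //.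
      + lra.
      + lra.
      + exact: equal_weights_upper.
  rewrite mean_ratioE// normrM normfV.
  set A := wsum q x `^ alpha; set G := gmean q x `^ alpha.
  set M := rmean r q x `^ (r * alpha).
  have GA : G <= A.
    by rewrite ge0_ler_powR ?(ltW al0) ?nnegrE ?gmean_ge0 ?(ltW A0)// gmean_le_wsum.
  have key : (1 - C) * (A - G) <= A - M.
    by move: main; rewrite /defect -/A -/G -/M; lra.
  have C1' : 0 < 1 - C by rewrite subr_gt0.
  rewrite ler_pdivlMr// [`|A - G|]ger0_norm ?subr_ge0//.
  (* A quotient with denominator 0 is 0. *)
  have [->|AM] := eqVneq (A - M) 0; first by rewrite normr0 invr0 mulr0 mul0r.
  rewrite mulrAC ler_pdivrMr ?normr_gt0// mul1r mulrC.
  exact: le_trans key (ler_norm _).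
- move=> a1 am n q x n2 hq hx; have [x0 _] := hx.
  have am' : a <= min_a r by apply: le_trans am _; rewrite ge_min lexx orbT.
  have ar : a <= 1 - 1 / r by apply: le_trans am _; rewrite ge_min lexx.
  set w := min_weight q; set alpha := 1 - a.
  have w0 : 0 < w := min_weight_gt0 _ _ _ hq.
  have w1 : w < 1 := min_weight_lt1 _ _ _ _ n2 hq hx.
  have al0 : 0 < alpha by rewrite subr_gt0.
  have al1 : alpha <= 1 by rewrite gerBl ltW.
  have ral : 1 <= r * alpha.
    by rewrite mulrC -ler_pdivrMr// /alpha; lra.
  set C := w `^ (alpha * (r - 1)).
  have C1 : C < 1 by rewrite powR_lt1 ?mulr_gt0// w0.
  have A0 := wsum_gt0 _ _ _ _ n2 hq hx.
  have main : defect r alpha C (1 - C) q x <= 0.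
    apply: (@defect_le0 R n r alpha w q) => //.
    - exact: min_weight_le.
    - exact: (Ordinal n2).
    - move=> z k z0 zk; rewrite /C [alpha * _]mulrC !powRrM.
      have z1 : 0 <= wsum q z.
        by apply: sumr_ge0 => i _; rewrite mulr_ge0// ltW// (proj1 hq).
      rewrite -powRM ?powR_ge0//.
      rewrite ge0_ler_powR ?nnegrE ?powR_ge0 ?(ltW al0) ?mulr_ge0 ?powR_ge0//.
      apply: rmean_superadditive => //; first exact: ltW.
      exact: min_weight_le.
    - move=> Q t t01 Q01 wQ wQ'; apply: two_point_lower => //.
      + by rewrite al0.
      + exact: ltW.
      + exact: equal_weights_lower.
  rewrite mean_ratioE// normrM normfV.
  set A := wsum q x `^ alpha; set G := gmean q x `^ alpha.
  set M := rmean r q x `^ (r * alpha).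
  (* Strictness matters: with denominator 0 the ratio would be 0. *)
  have MA : M < A.
    have [i [j [xij _]]] := two_coords _ _ _ n2 hx.
    rewrite /M powRrM gt0_ltr_powR ?nnegrE ?powR_ge0 ?(ltW A0)//.
    exact: (@rmean_lt_wsum R n r q x hr hq x0 i j).
  have key : A - M <= (1 - C) * (A - G).
    by move: main; rewrite /defect -/A -/G -/M; lra.
  have C1' : 0 < 1 - C by rewrite subr_gt0.
  rewrite [`|A - M|]gtr0_norm ?subr_gt0//.
  rewrite ler_pdivrMr// mulrAC ler_pdivlMr ?subr_gt0// mul1r mulrC.
  by apply: (le_trans key); rewrite ler_wpM2l ?(ltW C1')// ler_norm.
Qed.
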